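(* Let $q$ be a prime power, $d\geq 1$, and let $\omega$ and $\omega'$ be generators of the multiplicative group $F_q^*$. Then the Hamming maps $\mathcal H(d,\omega)$ and $\mathcal H(d,\omega')$ are isomorphic if and only if $\omega$ and $\omega'$ are conjugate under the Galois group of $F_q$ (i.e. $\omega'=\omega^{p^k}$ for some $k$, where $p$ is the characteristic).
   Context: Let $F_q$ be the field with $q$ elements, $n=d(q-1)$, $V=F_q^d$ (row vectors) with standard basis $e_1,\dots,e_d$. For a generator $\omega$ of $F_q^*$ let $M_\omega$ be the $d\times d$ matrix with entries $m_{i,i+1}=1$ for $1\le i\le d-1$, $m_{d,1}=\omega$, and all other entries $0$. The Hamming map $\mathcal H(d,\omega)$ is the Cayley map (on a compact oriented surface) of the additive group $V$ with respect to the generating set $S=\{\lambda e_i:\lambda\in F_q^*,1\le i\le d\}$, in which the rotation at every vertex $v$ sends the neighbour $v+e_1M_\omega^{i}$ to $v+e_1M_\omega^{i+1}$ (indices mod $n$); i.e. the cyclic order of neighbours of $v$ is $v+e_1,\dots,v+e_d,v+\omega e_1,\dots,v+\omega^{q-2}e_d$. Maps are isomorphic if there is an orientation-preserving isomorphism between them. *)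

(* Defs.v *)
From mathcomp Require Export all_boot all_order all_algebra.
From mathcomp Require Export all_fingroup all_solvable all_field.

Set Implicit Arguments.
Unset Strict Implicit.
Unset Printing Implicit Defensive.

Import GRing.Theory FinRing.Theory.
Local Open Scope ring_scope.

(* A map on a compact connected oriented surface is encoded by its finite set
   of darts (directed edges), the permutation rotating each dart to the next
   one around its initial vertex following the orientation, and the
   fixed-point-free involution reversing each dart; vertices, edges and faces
   are the cycles of rotation, of reversal, and of their composite. *)
Record oriented_map : Type := OrientedMap {
  dart : finType;
  rotation : dart -> dart;
  reversal : dart -> dart;
  rotation_inj : injective rotation;
  reversalK : involutive reversal;
  reversal_neq : forall x, reversal x != x;
  map_connected :
    forall x y, connect [rel a b | (b == rotation a) || (b == reversal a)] x y }.

(* The orientation is preserved since f commutes with the rotations, rather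
   than conjugating one to the inverse of the other. *)
Definition map_isomorphic (A B : oriented_map) : Prop :=
  exists f : dart A -> dart B,
    [/\ bijective f,
        forall x, f (rotation x) = rotation (f x)
      & forall x, f (reversal x) = reversal (f x)].

Section CayleyMap.

Variables (G : finZmodType) (S : {set G}) (rho : G -> G).

(* S is a symmetric generating set without 0 and rho restricts to a single
   cycle on S; the values of rho outside S are irrelevant. *)
Record cayley_rotation : Prop := CayleyRotation {
  cayley_neq0 : 0 \notin S;
  cayley_opp : {in S, forall s, - s \in S};
  cayley_gen : <<S>>%g = [set: G];
  cayley_stable : {in S, forall s, rho s \in S};
  cayley_cycle : {in S &, forall s t, fconnect rho s t} }.

Definition arc : finType := {x : G * G | x.2 - x.1 \in S}.

Hypothesis cay : cayley_rotation.

Lemma cayley_rot_subproof (x : arc) :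
  (val x).1 + rho ((val x).2 - (val x).1) - (val x).1 \in S.
Proof. by rewrite addrC addKr; apply: cayley_stable cay _ (valP x). Qed.

Lemma cayley_rev_subproof (x : arc) : (val x).1 - (val x).2 \in S.
Proof. by rewrite -opprB; apply: cayley_opp cay _ (valP x). Qed.

Definition cayley_rot (x : arc) : arc :=
  exist _ ((val x).1, (val x).1 + rho ((val x).2 - (val x).1))
    (cayley_rot_subproof x).

Definition cayley_rev (x : arc) : arc :=
  exist _ ((val x).2, (val x).1) (cayley_rev_subproof x).

Lemma rho_inj_in : {in S &, injective rho}.
Proof.
move=> s t Ss St eq_st; have Sr := cayley_stable cay Ss.
have /iter_findex := cayley_cycle cay Sr Ss.
have /iter_findex := cayley_cycle cay Sr St.
move: (findex _ _ t) (findex _ _ s) => l k Dt Ds.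
have El : iter l.+1 rho (rho s) = rho s by rewrite iterS Dt -eq_st.
have Ek : iter k.+1 rho (rho s) = rho s by rewrite iterS Ds.
by rewrite -Ds -El -Dt -{2}Ek -!iterD !addnS addnC.
Qed.

Lemma cayley_rot_inj : injective cayley_rot.
Proof.
move=> [[v w] /= Hx] [[v' w'] /= Hy] /(congr1 val) /= [Ev].
subst v' => /addrI E; apply: val_inj => /=; congr pair.
exact: (addIr (- v)) (rho_inj_in Hx Hy E).
Qed.

Lemma cayley_revK : involutive cayley_rev.
Proof. by move=> x; apply: val_inj => /=; case: (val x). Qed.

Lemma cayley_rev_neq x : cayley_rev x != x.
Proof.
apply/eqP=> /(congr1 val) /=; case: x => [[v w] /= Hx] [E _].
by move: Hx; rewrite E subrr (negPf (cayley_neq0 cay)).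
Qed.

Let step := [rel a b | (b == cayley_rot a) || (b == cayley_rev a)].

Lemma cayley_connected_vertex (x y : arc) :
  (val x).1 = (val y).1 -> connect step x y.
Proof.
move=> Exy; have /iter_findex := cayley_cycle cay (valP x) (valP y).
move: (findex _ _ _) => k; elim: k x Exy => [|k IHk] x Exy.
  rewrite /= Exy => /addIr E; suff -> : x = y by apply: connect0.
  by apply: val_inj; rewrite [LHS]surjective_pairing Exy E -surjective_pairing.
rewrite iterSr => E; apply: (@connect_trans _ _ (cayley_rot x)).
  by apply: connect1; rewrite /= eqxx.
by apply: IHk => //=; rewrite [(val x).1 + _]addrC addrK.
Qed.

Lemma cayley_connected (x y : arc) : connect step x y.
Proof.
pose H := [set u : G | [forall a : arc, forall b : arc,
  ((val b).1 == (val a).1 + u) ==> connect step a b]].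
have HP u : reflect
    (forall a b : arc, (val b).1 = (val a).1 + u -> connect step a b) (u \in H).
  rewrite inE; apply: (iffP forallP) => [h a b /eqP | h a].
    by have /forallP/(_ b)/implyP := h a.
  by apply/forallP=> b; apply/implyP=> /eqP; apply: h.
have gH : group_set H.
  apply/group_setP; split.
    by apply/HP=> a b; rewrite zmod1gE addr0 => E; apply: cayley_connected_vertex.
  move=> u v /HP Hu /HP Hv; apply/HP=> a b; rewrite zmodMgE => E.
  have Hc : (val a).2 + u - ((val a).1 + u) \in S.
    by rewrite opprD addrACA subrr addr0; apply: (valP a).
  pose c : arc := exist _ ((val a).1 + u, (val a).2 + u) Hc.
  apply: (@connect_trans _ _ c); first exact: Hu.
  by apply: Hv; rewrite E /= addrA.
have sSH : <<S>>%g \subset group gH.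
  rewrite gen_subG; apply/subsetP=> s Ss; apply/HP=> a b E.
  have Hc : (val a).1 + s - (val a).1 \in S by rewrite addrC addKr.
  pose c : arc := exist _ ((val a).1, (val a).1 + s) Hc.
  apply: (@connect_trans _ _ c); first exact: cayley_connected_vertex.
  apply: (@connect_trans _ _ (cayley_rev c)).
    by apply: connect1; rewrite /= eqxx orbT.
  exact: cayley_connected_vertex.
have /HP : (val y).1 - (val x).1 \in H.
  by apply: (subsetP sSH); rewrite (cayley_gen cay) inE.
by apply; rewrite addrC subrK.
Qed.

(* The rotation at v sends the neighbour w = v + s of v to v + rho s. *)
Definition cayley_map : oriented_map :=
  OrientedMap cayley_rot_inj cayley_revK cayley_rev_neq cayley_connected.

End CayleyMap.

Section HammingMap.

Variables (F : finFieldType) (d : nat).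

(* Coordinates are numbered from 0 to d - 1. *)
Definition hamming_set : {set 'rV[F]_d} :=
  [set x.1 *: delta_mx 0 x.2 | x : F * 'I_d & x.1 != 0].

Definition hamming_mx (w : F) : 'M[F]_d :=
  \matrix_(i, j) if j == i.+1 :> nat then 1
                 else if (i.+1 == d) && (j == 0%N :> nat) then w else 0.

Variable w : {unit F}.
Hypothesis gen_w : generator [set: {unit F}] w.

Local Notation rho := (fun s : 'rV[F]_d => s *m hamming_mx (val w)).

Lemma hamming_setP v : reflect
  (exists2 lam : F, lam != 0 & exists i : 'I_d, v = lam *: delta_mx 0 i)
  (v \in hamming_set).
Proof.
apply: (iffP imsetP) => [[[lam i]] | [lam nz [i ->]]].
  by rewrite inE /= => nz ->; exists lam => //; exists i.
by exists (lam, i); rewrite ?inE.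
Qed.

Lemma hamming_mx_next (i j : 'I_d) (lam : F) : j = i.+1 :> nat ->
  rho (lam *: delta_mx 0 i) = lam *: delta_mx 0 j.
Proof.
move=> Dj; rewrite /= -scalemxAl -rowE; congr (_ *: _); apply/rowP=> k.
rewrite !mxE -Dj eqxx /= -val_eqE /=; case: (k =P j :> nat) => //= _.
by rewrite Dj ltn_eqF // -Dj ltn_ord.
Qed.

Lemma hamming_mx_last (i j : 'I_d) (lam : F) :
    i.+1 = d -> j = 0%N :> nat ->
  rho (lam *: delta_mx 0 i) = (val w * lam) *: delta_mx 0 j.
Proof.
move=> Di Dj; rewrite /= -scalemxAl -rowE mulrC -scalerA; congr (_ *: _).
apply/rowP=> k; rewrite !mxE Di eqxx ltn_eqF //= -val_eqE /= Dj.
by case: eqP; rewrite ?mulr1 ?mulr0.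
Qed.

Lemma hamming_iter (i : 'I_d) (k : nat) (lam : F) : forall j : 'I_d,
  j = (i + k)%N :> nat ->
  fconnect rho (lam *: delta_mx 0 i) (lam *: delta_mx 0 j).
Proof.
elim: k => [|k IHk] j Dj.
  by rewrite (_ : j = i) ?connect0 //; apply: val_inj; rewrite /= Dj addn0.
have ltk : (i + k < d)%N by rewrite -addnS -Dj ltnW.
apply: (connect_trans (IHk (Ordinal ltk) erefl)); apply: connect1.
by apply/eqP/hamming_mx_next; rewrite Dj addnS.
Qed.

Lemma hamming_cayley_rotation : cayley_rotation hamming_set rho.
Proof.
have nzw : val w != 0 by rewrite -unitfE (valP w).
split.
- apply/hamming_setP=> -[lam nz [i /rowP/(_ i)/eqP]].
  by rewrite !mxE !eqxx mulr1 eq_sym (negPf nz).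
- move=> _ /hamming_setP[lam nz [i ->]]; apply/hamming_setP.
  by exists (- lam); rewrite ?oppr_eq0 //; exists i; rewrite scaleNr.
- apply/eqP; rewrite eqEsubset subsetT; apply/subsetP=> v _.
  rewrite (row_sum_delta v); apply: (big_ind (fun u => u \in <<hamming_set>>%g)).
  + exact: group1.
  + by move=> x y Sx Sy; apply: (groupM Sx Sy).
  move=> i _; have [->|nz] := eqVneq (v 0 i) 0; first by rewrite scale0r group1.
  by apply/mem_gen/hamming_setP; exists (v 0 i) => //; exists i.
- move=> _ /hamming_setP[lam nz [i ->]]; apply/hamming_setP.
  have [Di|ltid] := eqVneq i.+1 d.
    have d_gt0 : (0 < d)%N by rewrite -Di.
    exists (val w * lam); first by rewrite mulf_neq0.
    by exists (Ordinal d_gt0); apply: hamming_mx_last.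
  have lt_i1 : (i.+1 < d)%N by rewrite ltn_neqAle ltid ltn_ord.
  by exists lam => //; exists (Ordinal lt_i1); apply: hamming_mx_next.
move=> _ _ /hamming_setP[lam nzl [i ->]] /hamming_setP[mu nzm [j ->]].
have d_gt0 : (0 < d)%N by apply: leq_ltn_trans (ltn_ord i).
have lt_pd : (d.-1 < d)%N by rewrite prednK.
pose o : 'I_d := Ordinal d_gt0; pose m : 'I_d := Ordinal lt_pd.
have turn (k : 'I_d) (c : F) :
    fconnect rho (c *: delta_mx 0 k) ((val w * c) *: delta_mx 0 o).
  apply: (@connect_trans _ _ (c *: delta_mx 0 m)).
    by apply: (@hamming_iter _ (d.-1 - k)); rewrite /= subnKC // -ltnS prednK.
  by apply/connect1/eqP/hamming_mx_last; rewrite //= prednK.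
have turns k c : fconnect rho (c *: delta_mx 0 o) ((val w ^+ k * c) *: delta_mx 0 o).
  elim: k => [|k IHk]; first by rewrite expr0 mul1r connect0.
  by rewrite exprS -mulrA; apply: connect_trans IHk (turn _ _).
apply: (connect_trans (turn i lam)).
have Um : mu / (val w * lam) \is a GRing.unit.
  by rewrite unitfE mulf_neq0 // invr_eq0 mulf_neq0.
have : FinRing.unit F Um \in <[w]>%g by rewrite -(eqP gen_w) inE.
case/cycleP=> k /(congr1 val); rewrite val_unitX /= => Dk.
have := turns k (val w * lam); rewrite -Dk divfK ?mulf_neq0 // => /connect_trans-> //.
exact: (@hamming_iter _ j).
Qed.

Definition hamming_map : oriented_map := cayley_map hamming_cayley_rotation.

End HammingMap.

(* The Galois group of F over its prime subfield; [pPrimeCharType pcharF] is F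
   viewed as an extension of 'F_p. *)
Definition galois_conjugate (F : finFieldType) (p : nat)
    (pcharF : p \in [pchar F]) (x y : F) : Prop :=
  exists2 g : gal_of {:pPrimeCharType pcharF},
    g \in 'Gal({:pPrimeCharType pcharF} / 1)%g & g x = y.

(* Main.v *)
(* Turning d times around a vertex v sends each neighbour v + s to v + w s,
   because M_w^d = w I.  Walking along the line through 0 and e_1 therefore
   shows that an isomorphism turns every relation 1 - w^k = w^l into
   1 - w'^k = w'^l, so that w^k |-> w'^k extends to a field automorphism.
   Conversely, an automorphism of F taking w to w' acts on coordinates and
   takes M_w to M_w'. *)
From HB Require Import structures.
Require Import Defs.

Set Implicit Arguments.
Unset Strict Implicit.
Unset Printing Implicit Defensive.

Import GRing.Theory.
Local Open Scope ring_scope.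

(** * Iterated rotations and the relations that isomorphisms preserve *)

Lemma val_iter_cayley_rot (G : finZmodType) (S : {set G}) (rho : G -> G)
    (cay : cayley_rotation S rho) (k : nat) (x : arc S) :
  val (iter k (cayley_rot cay) x)
    = ((val x).1, (val x).1 + iter k rho ((val x).2 - (val x).1)).
Proof.
elim: k => [|k IHk] /=; first by rewrite addrC subrK; case: (val x).
by rewrite IHk /= [X in rho X]addrC addKr.
Qed.

(** [rho] is a single cycle on [S]. Sharing an initial vertex thus becomes a word in the rotation,
    which every isomorphism respects. *)
Lemma cayley_rot_same_vertex (G : finZmodType) (S : {set G}) (rho : G -> G)
    (cay : cayley_rotation S rho) (x y : arc S) :
  (val x).1 = (val y).1 -> exists k, y = iter k (cayley_rot cay) x.
Proof.
move=> Exy; have /iter_findex := cayley_cycle cay (valP x) (valP y).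
move: (findex _ _ _) => k Dk; exists k; apply: val_inj.
rewrite val_iter_cayley_rot Dk Exy [X in (_, X)]addrC subrK.
by case: (val y).
Qed.

Lemma iter_hamming_mx_shift (F : finFieldType) (d : nat) (w : {unit F})
    (k : nat) (lam : F) (i j : 'I_d) : j = (i + k)%N :> nat ->
  iter k (mulmx^~ (hamming_mx d (val w))) (lam *: delta_mx 0 i : 'rV_d)
    = lam *: delta_mx 0 j.
Proof.
elim: k j => [|k IHk] j Dj.
  by congr (_ *: delta_mx 0 _); apply: val_inj; rewrite [RHS]Dj addn0.
have ltk : (i + k < d)%N by rewrite -addnS -Dj ltnW.
rewrite iterS (IHk (Ordinal ltk)) //.
by apply: hamming_mx_next; rewrite Dj addnS.
Qed.

(** Among [d] consecutive shifts of the index, exactly one wraps from the last coordinate to the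
    first, and only that one multiplies by [w]. *)
Lemma iter_hamming_mx_turn (F : finFieldType) (d : nat) (w : {unit F}) :
  {in hamming_set F d, forall s,
    iter d (mulmx^~ (hamming_mx d (val w))) s = val w *: s}.
Proof.
move=> _ /hamming_setP[lam _ [i ->]].
have d_gt0 : (0 < d)%N by apply: leq_ltn_trans (ltn_ord i).
have lt_pd : (d.-1 < d)%N by rewrite prednK.
(* First [d.-1 - i] shifts reach the last coordinate, one more wraps around, and [i] shifts lead
   back to [i]. *)
have Dd : d = (i + (d.-1 - i).+1)%N by rewrite addnS subnKC ?prednK // -ltnS prednK.
rewrite [X in iter X]Dd iterD iterS (@iter_hamming_mx_shift _ _ _ _ _ _ (Ordinal lt_pd)).
  rewrite (@hamming_mx_last _ _ _ _ (Ordinal d_gt0)) ?prednK //.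
  by rewrite (@iter_hamming_mx_shift _ _ _ _ _ _ i) ?add0n // scalerA.
by rewrite /= subnKC // -ltnS prednK.
Qed.

Lemma iter_hamming_mx_turns (F : finFieldType) (d : nat) (w : {unit F}) k :
  {in hamming_set F d, forall s,
    iter (k * d) (mulmx^~ (hamming_mx d (val w))) s = val w ^+ k *: s}.
Proof.
move=> s Ss; elim: k => [|k IHk]; first by rewrite scale1r.
rewrite mulSn iterD IHk iter_hamming_mx_turn ?scalerA -?exprS //.
case/hamming_setP: Ss => lam nz [i ->]; rewrite scalerA; apply/hamming_setP.
exists (val w ^+ k * lam); last by exists i.
by rewrite mulf_neq0 // expf_neq0 // -unitfE (valP w).
Qed.

Lemma hamming_rotation_turns (F : finFieldType) (d : nat) (w : {unit F})
    (gen_w : generator [set: {unit F}] w) (k : nat)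
    (x : dart (hamming_map d gen_w)) :
  val (iter (k * d) (@rotation _) x)
    = ((val x).1, (val x).1 + val w ^+ k *: ((val x).2 - (val x).1)).
Proof.
by rewrite val_iter_cayley_rot iter_hamming_mx_turns //; apply: (valP x).
Qed.

(* The paths 0 -> e_1 -> (1 - w^k) e_1 and 0 -> w^l e_1 end at the same vertex;
   read as words in the rotation and the reversal, they must also end at a
   common vertex in the image map. *)
Lemma hamming_iso_subr (F : finFieldType) (d : nat) (w w' : {unit F})
    (gen_w : generator [set: {unit F}] w)
    (gen_w' : generator [set: {unit F}] w') (k l : nat) :
    (0 < d)%N ->
    map_isomorphic (hamming_map d gen_w) (hamming_map d gen_w') ->
  1 - val w ^+ k = val w ^+ l -> 1 - val w' ^+ k = val w' ^+ l.
Proof.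
move=> d_gt0 [f [_ f_rot f_rev]] Dkl.
have f_iter m x : f (iter m (@rotation _) x) = iter m (@rotation _) (f x).
  by elim: m => //= m IHm; rewrite f_rot IHm.
pose e : 'rV[F]_d := delta_mx 0 (Ordinal d_gt0).
have Se : e - 0 \in hamming_set F d.
  rewrite subr0; apply/hamming_setP; exists 1; first exact: oner_neq0.
  by exists (Ordinal d_gt0); rewrite scale1r.
pose x : dart (hamming_map d gen_w) := exist _ (0, e) Se.
(* The outer reversals turn the ends of the two paths into initial vertices: [(1 - w^k) e] for [y]
   and [w^l e] for [z]. *)
pose y := reversal (iter (k * d) (@rotation _) (reversal x)).
pose z := reversal (iter (l * d) (@rotation _) x).
have Eyz : (val y).1 = (val z).1.
  rewrite [LHS](congr1 snd (hamming_rotation_turns _ _)).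
  rewrite [RHS](congr1 snd (hamming_rotation_turns _ _)) /=.
  by rewrite !sub0r add0r subr0 -Dkl scalerN scalerBl scale1r.
have [m Dz] := cayley_rot_same_vertex (hamming_cayley_rotation d gen_w) Eyz.
have : (val (f y)).1 = (val (f z)).1.
  by rewrite Dz f_iter val_iter_cayley_rot.
rewrite /y /z !f_rev !f_iter f_rev.
rewrite [X in X = _](congr1 snd (hamming_rotation_turns _ _)).
rewrite [X in _ = X](congr1 snd (hamming_rotation_turns _ _)) /=.
(* The image of [x] may be any dart from [a] to [b], but [b - a = lam e_i] with [lam] nonzero, so
   comparing coordinate [i] and cancelling [lam] suffices. *)
case: (f x) => -[a b] /= Sab.
have -> : b + val w' ^+ k *: (a - b) = a + (1 - val w' ^+ k) *: (b - a).
  by rewrite -(opprB b) scalerN scalerBl scale1r addrA [a + _]addrC subrK.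
case/hamming_setP: Sab => lam nz [i ->] /addrI/rowP/(_ i).
by rewrite !mxE !eqxx mulr1 => /(mulIf nz).
Qed.

(** * From matching powers of generators to a field automorphism *)

Lemma generator_pow (F : finFieldType) (w : {unit F}) (x : F) :
  generator [set: {unit F}] w -> x != 0 -> exists k, x = val w ^+ k.
Proof.
move=> gen_w nzx; have Ux : x \is a GRing.unit by rewrite unitfE.
have : FinRing.unit F Ux \in <[w]>%g by rewrite -(eqP gen_w) inE.
by case/cycleP=> k /(congr1 val); rewrite FinRing.val_unitX; exists k.
Qed.

(** Both generators have the order of the whole unit group. Hence [w^k |-> w'^k] is well defined and
    injective. *)
Lemma generator_eq_pow (F : finFieldType) (w w' : {unit F}) (k l : nat) :
    generator [set: {unit F}] w -> generator [set: {unit F}] w' ->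
  (val w ^+ k == val w ^+ l) = (val w' ^+ k == val w' ^+ l).
Proof.
move=> /eqP gen_w /eqP gen_w'.
rewrite -!FinRing.val_unitX !val_eqE !eq_expg_mod_order.
by rewrite !orderE -gen_w -gen_w'.
Qed.

(* The map w^k |-> w'^k, 0 |-> 0 commutes with x |-> 1 - x, and
   x - y = x (1 - y / x). *)
Lemma generator_rmorphism (F : finFieldType) (w w' : {unit F}) :
    generator [set: {unit F}] w -> generator [set: {unit F}] w' ->
    (forall k l, 1 - val w ^+ k = val w ^+ l ->
       1 - val w' ^+ k = val w' ^+ l) ->
  exists s : {rmorphism F -> F}, s (val w) = val w'.
Proof.
move=> gen_w gen_w' Hsub.
have nzw : val w != 0 by rewrite -unitfE (valP w).
have nzX k : val w ^+ k != 0 by rewrite expf_neq0.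
(* Exponents below the order of the unit group reach every nonzero element, so the default value is
   taken only at 0. *)
pose psi (x : F) :=
  if [pick k : 'I_#|[set: {unit F}]| | val w ^+ k == x] is Some k then val w' ^+ k
  else 0.
have psi0 : psi 0 = 0.
  by rewrite /psi; case: pickP => // k; rewrite (negPf (nzX k)).
have psiX k : psi (val w ^+ k) = val w' ^+ k.
  rewrite /psi; case: pickP => [j | noj].
    by rewrite (generator_eq_pow _ _ gen_w gen_w') => /eqP.
  have o_w : #[w]%g = #|[set: {unit F}]| by rewrite orderE -(eqP gen_w).
  have lt_k : (k %% #[w]%g < #|[set: {unit F}]|)%N by rewrite -o_w ltn_mod order_gt0.
  have /eqP[] := noj (Ordinal lt_k).
  by rewrite /= -!FinRing.val_unitX expg_mod_order.
have psi1 : psi 1 = 1 by apply: (psiX 0).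
have psiM : {morph psi : x y / x * y}.
  move=> x y; have [->|nzx] := eqVneq x 0; first by rewrite !(mul0r, psi0).
  have [->|nzy] := eqVneq y 0; first by rewrite !(mulr0, psi0).
  have [k ->] := generator_pow gen_w nzx.
  have [l ->] := generator_pow gen_w nzy.
  by rewrite -exprD !psiX exprD.
have psi1B x : psi (1 - x) = 1 - psi x.
  have [->|nzx] := eqVneq x 0; first by rewrite psi0 !subr0.
  have [->|nzx1] := eqVneq x 1; first by rewrite psi1 !subrr.
  have nz1x : 1 - x != 0 by rewrite subr_eq0 eq_sym.
  have [k Dk] := generator_pow gen_w nzx.
  have [l Dl] := generator_pow gen_w nz1x.
  by rewrite Dl Dk !psiX (Hsub k l) // -Dk.
have psiN1 : psi (-1) = -1.
  have [m Dm] : exists m, -1 = val w ^+ m.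
    by apply: generator_pow; rewrite // oppr_eq0 oner_eq0.
  have : psi (-1) ^+ 2 == 1 by rewrite expr2 -psiM mulrNN mulr1 psi1.
  rewrite sqrf_eq1 => /orP[]/eqP // E.
  suff E1 : (-1 : F) = 1 by rewrite E1.
  apply/eqP; rewrite {1}Dm -[X in _ == X](expr0 (val w)).
  by rewrite (generator_eq_pow _ _ gen_w gen_w') -psiX -Dm E.
have psiB : {morph psi : x y / x - y}.
  move=> x y; have [->|nzx] := eqVneq x 0.
    by rewrite psi0 !sub0r -mulN1r psiM psiN1 mulN1r.
  have -> : x - y = x * (1 - y / x) by rewrite mulrBr mulr1 mulrCA divff ?mulr1.
  by rewrite psiM psi1B mulrBr mulr1 -psiM mulrCA divff ?mulr1.
pose psi_add := GRing.isZmodMorphism.Build F F psi psiB.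
pose psi_mul := GRing.isMonoidMorphism.Build F F psi (psi1, psiM).
pose s : {rmorphism F -> F} := HB.pack psi psi_add psi_mul.
by exists s; apply: (psiX 1).
Qed.

(** * Field endomorphisms, the Galois group and Frobenius powers *)

Lemma rmorphism_galois_conjugate (F : finFieldType) (p : nat)
    (pcharF : p \in [pchar F]) (s : {rmorphism F -> F}) (x : F) :
  galois_conjugate pcharF x (s x).
Proof.
pose L := pPrimeCharType pcharF.
pose sL : L -> L := s.
have sB : zmod_morphism sL by apply: rmorphB.
(* A scalar of ['F_p] acts as a natural multiple, which any additive map preserves. *)
have sZ : scalable sL.
  by move=> a u; rewrite ![_ *: _]mulr_natl; apply: (rmorphMn s).
pose s_add := GRing.isZmodMorphism.Build L L sL sB.
pose s_scale := GRing.isScalable.Build _ L L *:%R sL sZ.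
pose s_lin : {linear L -> L} := HB.pack sL s_add s_scale.
have sM : kHom 1 {:L} (linfun s_lin).
  apply/kHom_monoid_morphism; split=> [|u v].
    by rewrite lfunE; apply: (rmorph1 s).
  by rewrite !lfunE; apply: (rmorphM s).
(* On the full field an endomorphism over the base is already an automorphism. *)
rewrite -kAutfE in sM; have [g Gg Dg] := kAut_to_gal sM.
by exists g => //; rewrite -Dg ?memvf // lfunE.
Qed.

(** The Galois group is cyclic, generated by the Frobenius map [u |-> u^p]. *)
Lemma galois_conjugateP (F : finFieldType) (p : nat)
    (pcharF : p \in [pchar F]) (x y : F) :
  galois_conjugate pcharF x y <-> exists k : nat, y = x ^+ (p ^ k).
Proof.
pose L := pPrimeCharType pcharF.
have [a gen_a Da] := @finField_galois_generator _ L 1%AS {:L}%AS (subvf _).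
have DaX k (u : L) : (a ^+ k)%g u = u ^+ (p ^ k).
  elim: k => [|k IHk]; first by rewrite expr1 gal_id.
  rewrite expgSr galM ?memvf // IHk Da ?memvf // card_Fp ?(pcharf_prime pcharF) //.
  by rewrite dimv1 expn1 -exprM expnSr.
split=> [[g Gg <-] | [k ->]].
  by move: Gg; rewrite (eqP gen_a) => /cycleP[k ->]; exists k; apply: DaX.
by exists (a ^+ k)%g; rewrite ?(eqP gen_a) ?mem_cycle //; apply: DaX.
Qed.

Lemma iter_Frobenius_rmorphism (F : finFieldType) (p : nat)
    (pcharF : p \in [pchar F]) (k : nat) :
  exists s : {rmorphism F -> F}, forall x, s x = x ^+ (p ^ k).
Proof.
elim: k => [|k [s Ds]]; first by exists (idfun : {rmorphism F -> F}).
exists (pFrobenius_aut pcharF \o s : {rmorphism F -> F}) => x /=.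
by rewrite pFrobenius_autE Ds -exprM expnSr.
Qed.

(** * From a field automorphism to a map isomorphism *)

Lemma hamming_iso_rmorphism (F : finFieldType) (d : nat) (w w' : {unit F})
    (gen_w : generator [set: {unit F}] w)
    (gen_w' : generator [set: {unit F}] w') (s : {rmorphism F -> F}) :
    s (val w) = val w' ->
  map_isomorphic (hamming_map d gen_w) (hamming_map d gen_w').
Proof.
move=> Dw'; pose h (v : 'rV[F]_d) := map_mx s v.
have hS (x : arc (hamming_set F d)) :
    (h (val x).1, h (val x).2).2 - (h (val x).1, h (val x).2).1
      \in hamming_set F d.
  rewrite /= -map_mxB; have /hamming_setP[lam nz [i ->]] := valP x.
  apply/hamming_setP; exists (s lam); first by rewrite fmorph_eq0.
  by exists i; rewrite map_mxZ map_delta_mx.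
pose f (x : arc (hamming_set F d)) : arc (hamming_set F d) :=
  exist _ (h (val x).1, h (val x).2) (hS x).
(* Injectivity is enough for bijectivity, since the set of darts is finite. *)
exists f; split=> [|x|x]; last by apply: val_inj.
  apply: injF_bij => x y /(congr1 val)[/map_mx_inj E1 /map_mx_inj E2].
  by apply: val_inj; rewrite [LHS]surjective_pairing E1 E2 -surjective_pairing.
(* The entries are only 0, 1 and [w], so [s] changes nothing but the corner entry. *)
have hM : map_mx s (hamming_mx d (val w)) = hamming_mx d (val w').
  apply/matrixP=> i j; rewrite !mxE; case: ifP; first by rewrite rmorph1.
  by case: ifP; rewrite ?rmorph0.
by apply: val_inj; rewrite /= /h map_mxD map_mxM map_mxB hM.
Qed.

Theorem theorem2p2 (F : finFieldType) (p : nat) (pcharF : p \in [pchar F])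
    (d : nat) (d_ge1 : (1 <= d)%N) (w w' : {unit F})
    (gen_w : generator [set: {unit F}] w)
    (gen_w' : generator [set: {unit F}] w') :
  (map_isomorphic (hamming_map d gen_w) (hamming_map d gen_w')
     <-> galois_conjugate pcharF (val w) (val w'))
  /\ (galois_conjugate pcharF (val w) (val w')
        <-> exists k : nat, val w' = val w ^+ (p ^ k)).
Proof.
split; last exact: galois_conjugateP.
split=> [iso | /galois_conjugateP[k Dw']].
  have [|s <-] := generator_rmorphism gen_w gen_w'.
    by move=> k l; apply: hamming_iso_subr iso.
  exact: rmorphism_galois_conjugate.
have [s Ds] := iter_Frobenius_rmorphism pcharF k.
by apply: (@hamming_iso_rmorphism _ _ _ _ _ _ s); rewrite Ds.
Qed.
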